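(* Let $G$ be a connected non-bipartite graph with vertices $t_1,\ldots,t_s$, let $K$ be a field with ${\rm char}(K)\neq 2$, and let $\mathbb{X}\subset\mathbb{P}^{s-1}$ be the set of points defined by the columns of the incidence matrix of $G$ over $K$. Then the edge biparticity $\varphi(G)$ of $G$ satisfies $$ \varphi(G)=\min\{|\mathbb{X}\setminus V_\mathbb{X}(h)| : h=a_1t_1+\cdots+a_st_s,\ a_i\in\{1,-1\}\text{ for all } i\}. $$
   Context: Graphs are finite and simple. The edge biparticity $\varphi(G)$ of a graph $G$ is the minimum number of edges whose removal makes the graph bipartite (and maybe not connected). If $G$ has vertices $t_1,\ldots,t_s$ and edges $f_1,\ldots,f_m$, its incidence matrix over $K$ is the $s\times m$ matrix $A=(a_{ij})$ with $a_{ij}=1$ if $t_i\in f_j$ and $a_{ij}=0$ otherwise; if $P_1,\ldots,P_m\in K^s$ are the columns of $A$, then $\mathbb{X}=\{[P_1],\ldots,[P_m]\}$ in the projective space $\mathbb{P}^{s-1}$ over $K$. The linear forms $h$ belong to the polynomial ring $K[t_1,\ldots,t_s]$ whose variables are identified with the vertices, and $V_\mathbb{X}(h)$ is the set of zeros of $h$ in $\mathbb{X}$. *)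

(* Defs.v *)
From mathcomp Require Import all_boot all_order all_algebra.
From mathcomp Require Import finmap mpoly.

Set Implicit Arguments.
Unset Strict Implicit.
Unset Printing Implicit Defensive.

Import GRing.Theory.
Local Open Scope ring_scope.
Local Open Scope fset_scope.

(* A graph on the vertices t_1, ..., t_s is given by its set of edges          *)
(* E : {set {set 'I_s}}, each edge being the set of its two ends.              *)

Definition simple_graph (s : nat) (E : {set {set 'I_s}}) : bool :=
  [forall f in E, #|f| == 2%N].

Definition adjacent (s : nat) (E : {set {set 'I_s}}) : rel 'I_s :=
  [rel x y | [set x; y] \in E].

Definition connected_graph (s : nat) (E : {set {set 'I_s}}) : bool :=
  [forall x, forall y, connect (adjacent E) x y].

Definition bipartite (s : nat) (E : {set {set 'I_s}}) : bool :=
  [exists A : {set 'I_s}, forall x, forall y,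
     adjacent E x y ==> ((x \in A) != (y \in A))].

(* The default value E is admissible (deleting every edge leaves a bipartite   *)
(* graph), so the arg min below is a genuine minimum.                          *)
Definition edge_biparticity (s : nat) (E : {set {set 'I_s}}) : nat :=
  #|[arg min_(F < E | (F \subset E) && bipartite (E :\: F)) #|F|]|.

Lemma edge_biparticity_default (s : nat) (E : {set {set 'I_s}}) :
  (E \subset E) && bipartite (E :\: E).
Proof.
rewrite subxx setDv; apply/existsP; exists set0.
by apply/forallP=> x; apply/forallP=> y; rewrite /adjacent /= inE.
Qed.

Definition incidence_matrix (K : fieldType) (s : nat) (E : {set {set 'I_s}}) :
    'M[K]_(s, #|E|) :=
  \matrix_(i < s, j < #|E|) (i \in enum_val j)%:R.

(* Points of the projective space P^(s-1) over K are lines (subspaces of       *)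
(* dimension 1) of K^s; the point [P] is the line <[P]> for P != 0.            *)
Definition incidence_points (K : fieldType) (s : nat) (E : {set {set 'I_s}}) :
    {fset {vspace 'cV[K]_s}} :=
  [fset <[col j (incidence_matrix K E)]>%VS | j : 'I_#|E|].

Lemma incidence_points_dim (K : fieldType) (s : nat) (E : {set {set 'I_s}}) p :
  simple_graph E -> p \in incidence_points K E -> \dim p = 1%N.
Proof.
move=> /forall_inP sE /imfsetP [j _ ->]; rewrite dim_vline.
have /card_gt0P [i fi] : (0 < #|enum_val j|)%N by rewrite (eqP (sE _ (enum_valP j))).
case: eqP => // /matrixP/(_ i ord0)/eqP.
by rewrite !mxE fi oner_eq0.
Qed.

(* Vanishing of h at a projective point is tested on the representative        *)
(* vpick p; for homogeneous h the choice is irrelevant, see vanishes_atE.      *)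
Definition vanishes_at (K : fieldType) (s : nat) (h : {mpoly K[s]})
    (p : {vspace 'cV[K]_s}) : bool :=
  h.@[fun i => vpick p i ord0] == 0.

Lemma vanishes_atE (K : fieldType) (s d : nat) (h : {mpoly K[s]})
    (v : 'cV[K]_s) :
  h \is d.-homog -> v != 0 ->
  vanishes_at h <[v]>%VS = (h.@[fun i => v i ord0] == 0).
Proof.
move=> hh v0; rewrite /vanishes_at.
have /vlineP [k vk] := memv_pick <[v]>%VS.
have k0 : k != 0.
  apply: contraNneq v0 => k0; have := memv_line v.
  move/eqP: vk; rewrite k0 scale0r vpick0 => /eqP ->.
  by rewrite memv0.
have -> : h.@[fun i => vpick <[v]>%VS i ord0] =
          k ^+ d * h.@[fun i => v i ord0].
  rewrite !mevalE mulr_sumr; apply: eq_big_seq => m mh.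
  have <- : mdeg m = d by have /dhomogP := hh; apply.
  rewrite mulrCA mdegE -prodrXr -big_split /=; congr (_ * _).
  by apply: eq_bigr => i _; rewrite vk mxE exprMn.
by rewrite mulf_eq0 expf_eq0 (negPf k0) andbF.
Qed.

Definition zeros_in (K : fieldType) (s : nat) (X : {fset {vspace 'cV[K]_s}})
    (h : {mpoly K[s]}) : {fset {vspace 'cV[K]_s}} :=
  [fset p in X | vanishes_at h p].

Definition linear_form (K : fieldType) (s : nat) (a : 'I_s -> K) : {mpoly K[s]} :=
  \sum_(i < s) a i *: 'X_i.

Lemma linear_form_homog (K : fieldType) (s : nat) (a : 'I_s -> K) :
  linear_form a \is 1.-homog.
Proof.
apply: rpred_sum => i _; apply: rpredZ.
by rewrite dhomogX; apply/eqP; exact: mdeg1.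
Qed.

Definition is_minimum (A : nat -> Prop) (m : nat) : Prop :=
  A m /\ (forall k, A k -> (m <= k)%N).

(* Main.v *)
Require Import Defs.
From mathcomp Require Import all_boot all_order all_algebra.
From mathcomp Require Import finmap mpoly.

Import GRing.Theory.
Local Open Scope ring_scope.
Local Open Scope fset_scope.

(** Both sides of the equality minimise the same quantity over two-colourings
    of the vertices.  A choice of signs a is the same thing as a colouring, the
    class A being the set of vertices with sign 1.  On the point of an edge
    {x, y} the form h takes the value a_x + a_y, which is 0 if the ends have
    different colours and 2 or -2 otherwise; as the characteristic is not 2,
    the points outside V(h) are exactly those of the monochromatic edges
    ([sum_signs_neq0]).  Distinct edges give distinct points because an edge is
    recovered as the support of any vector on its line ([edge_point_inj]), so
    the number of these points is the number of monochromatic edges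
    ([card_nonzeros]).

    On the other side, deleting F from G leaves a graph that is properly
    coloured by A precisely when F contains every monochromatic edge
    ([bipartite_setD]).  Hence the edge biparticity is the least number of
    monochromatic edges over all colourings. *)

(** Formulated through inclusions rather than through the two ends, so that no
    ends have to be chosen; the empty set would count as monochromatic. *)
Definition monochromatic {s : nat} (E : {set {set 'I_s}}) (A : {set 'I_s}) :
    {set {set 'I_s}} :=
  [set f in E | (f \subset A) || (f \subset ~: A)]%SET.

Lemma mem_monochromatic2 (s : nat) (E : {set {set 'I_s}}) A (x y : 'I_s) :
  ([set x; y] \in monochromatic E A) =
  ([set x; y] \in E) && ((x \in A) == (y \in A)).
Proof.
rewrite inE !subUset !sub1set !inE.
by case: (x \in A); case: (y \in A).
Qed.

Lemma simple_edgeP {s : nat} {E : {set {set 'I_s}}} {f : {set 'I_s}} :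
  simple_graph E -> f \in E -> exists x y, x != y /\ f = [set x; y]%SET.
Proof.
move=> /forall_inP sE /sE /cards2P [x [y [xy ->]]].
by exists x, y.
Qed.

(** A colouring is proper for G - F exactly when F has caught every edge on
    which it fails, so the same A serves in both directions. *)
Lemma bipartite_setD {s : nat} {E F : {set {set 'I_s}}} :
  simple_graph E ->
  reflect (exists A, monochromatic E A \subset F) (bipartite (E :\: F)).
Proof.
move=> sE; apply: (iffP existsP) => -[A hA]; exists A.
  apply/subsetP => f fM; have fE : f \in E by move: fM; rewrite inE => /andP[].
  have [x [y [_ fxy]]] := simple_edgeP sE fE.
  move: fM fE; rewrite fxy mem_monochromatic2 => /andP[_ cxy] xyE.
  apply: contraLR cxy => xyF.
  move/forallP/(_ x)/forallP/(_ y)/implyP: hA; apply.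
  by rewrite /adjacent /= inE xyF.
apply/forallP => x; apply/forallP => y; apply/implyP.
rewrite /adjacent /= inE => /andP[xyF xyE]; apply: contra xyF => cxy.
by apply: (subsetP hA); rewrite mem_monochromatic2 xyE.
Qed.

Definition edge_vector (K : fieldType) {s : nat} (f : {set 'I_s}) : 'cV[K]_s :=
  \col_i (i \in f)%:R.

Definition edge_point (K : fieldType) {s : nat} (f : {set 'I_s}) :
    {vspace 'cV[K]_s} :=
  <[edge_vector K f]>%VS.

(** If the line of f lies in the line of g, then the vector of f is a multiple
    of that of g, so its support f is contained in g. *)
Lemma edge_point_inj (K : fieldType) (s : nat) :
  injective (@edge_point K s).
Proof.
have sub (f g : {set 'I_s}) : edge_point K f = edge_point K g -> f \subset g.
  move=> fg; have := memv_line (edge_vector K f).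
  rewrite -/(edge_point K f) fg => /vlineP [k /matrixP fkg].
  apply/subsetP => i fi; apply: contraT => /negPf gi.
  by have := fkg i ord0; rewrite !mxE fi gi mulr0 => /eqP; rewrite oner_eq0.
by move=> f g fg; apply/eqP; rewrite eqEsubset !sub.
Qed.

Lemma edge_vector_neq0 {K : fieldType} {s : nat} {f : {set 'I_s}} :
  f != set0 -> edge_vector K f != 0.
Proof.
case/set0Pn => i fi; apply/eqP => /matrixP/(_ i ord0)/eqP.
by rewrite !mxE fi oner_eq0.
Qed.

Lemma incidence_pointsE (K : fieldType) (s : nat) (E : {set {set 'I_s}}) :
  incidence_points K E = [fset edge_point K f | f in E].
Proof.
have colE (j : 'I_#|E|) :
    col j (incidence_matrix K E) = edge_vector K (enum_val j).
  by apply/matrixP => i k; rewrite !mxE.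
apply/fsetP => p; apply/imfsetP/imfsetP => /= -[].
  by move=> j _ ->; exists (enum_val j); rewrite ?enum_valP // colE.
move=> f fE ->; exists (enum_rank_in fE f) => //.
by rewrite colE enum_rankK_in.
Qed.

Lemma vanishes_at_edge (K : fieldType) (s : nat) (a : 'I_s -> K) f :
  f != set0 ->
  vanishes_at (linear_form a) (edge_point K f) = (\sum_(i in f) a i == 0).
Proof.
move=> f0.
rewrite (vanishes_atE (linear_form_homog a) (edge_vector_neq0 f0)).
congr (_ == 0); rewrite /linear_form raddf_sum [RHS]big_mkcond /=.
apply: eq_bigr => i _; rewrite mevalZ mevalXU mxE.
by case: (i \in f); rewrite ?mulr1 ?mulr0.
Qed.

Lemma opp1_eq1 (K : fieldType) : 2%N \notin [pchar K] -> (-1 == 1 :> K) = false.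
Proof.
rewrite inE /= => two_neq0.
by rewrite eq_sym -subr_eq0 opprK -mulr2n (negPf two_neq0).
Qed.

(** The sum over the two ends is 2, -2 or 0. *)
Lemma sum_signs_neq0 (K : fieldType) (s : nat) (a : 'I_s -> K)
    (x y : 'I_s) :
  2%N \notin [pchar K] -> (forall i, a i = 1 \/ a i = -1) -> x != y ->
  (\sum_(i in [set x; y]%SET) a i != 0) = ((a x == 1) == (a y == 1)).
Proof.
move=> K2 aS xy; rewrite big_setU1 ?inE //= big_set1.
have two_neq0 : (1 + 1 != 0 :> K)%R by move: K2; rewrite inE /= mulr2n.
case: (aS x) => ->; case: (aS y) => ->; rewrite ?eqxx ?(opp1_eq1 _ K2) //.
- by rewrite subrr eqxx.
- by rewrite addNr eqxx.
- by rewrite -opprD oppr_eq0.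
Qed.

(** Counting points amounts to counting edges because distinct edges span
    distinct lines; the signs then select the monochromatic ones. *)
Lemma card_nonzeros (K : fieldType) (s : nat) (E : {set {set 'I_s}})
    (a : 'I_s -> K) :
  simple_graph E -> 2%N \notin [pchar K] -> (forall i, a i = 1 \/ a i = -1) ->
  #|` incidence_points K E `\` zeros_in (incidence_points K E) (linear_form a)|
  = #|monochromatic E [set i | a i == 1]%SET|.
Proof.
move=> sE K2 aS; set M := monochromatic E _.
have vanishE f : f \in E ->
    ~~ vanishes_at (linear_form a) (edge_point K f) = (f \in M).
  move=> fE; have [x [y [xy fxy]]] := simple_edgeP sE fE.
  rewrite vanishes_at_edge; last by rewrite -card_gt0 fxy cards2 xy.
  by rewrite fxy sum_signs_neq0 // mem_monochromatic2 -fxy fE !inE.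
have -> : incidence_points K E `\`
    zeros_in (incidence_points K E) (linear_form a) =
    [fset edge_point K f | f in M].
  rewrite incidence_pointsE; apply/fsetP => p; rewrite !inE /=.
  apply/andP/imfsetP => /= [[]|[f fM ->]].
    move=> pV /imfsetP[/= f fE pf]; exists f => //.
    by move: pV; rewrite pf in_imfset //= vanishE.
  have fE : f \in E by move: fM; rewrite inE => /andP[].
  by rewrite in_imfset // vanishE.
by rewrite card_imfset ?cardE //; exact: edge_point_inj.
Qed.

Theorem proposition2p3 (s : nat) (E : {set {set 'I_s}}) (K : fieldType)
    (E_simple : simple_graph E) (E_connected : connected_graph E)
    (E_nonbip : ~~ bipartite E) (charK : 2%N \notin [pchar K]) :
  is_minimum
    (fun k : nat => exists2 a : 'I_s -> K,
       forall i, a i = 1 \/ a i = -1 &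
       k = let X := incidence_points K E in
           #|` X `\` zeros_in X (linear_form a)|)
    (edge_biparticity E).
Proof.
rewrite /edge_biparticity.
case: arg_minnP => [|F /andP[_ /(bipartite_setD E_simple) [A AF]] minF].
  exact: edge_biparticity_default.
have le_mono B : (#|F| <= #|monochromatic E B|)%N.
  apply: minF; apply/andP; split.
    by apply/subsetP => f; rewrite inE => /andP[].
  by apply/(bipartite_setD E_simple); exists B.
split=> [|k [a aS ->]]; last by rewrite /= card_nonzeros.
pose a i : K := if i \in A then 1 else -1.
have aS i : a i = 1 \/ a i = -1 by rewrite /a; case: ifP; [left | right].
exists a => //=; rewrite card_nonzeros //.
have -> : [set i | a i == 1]%SET = A.
  apply/setP => i; rewrite inE /a; case: ifP => _; first exact: eqxx.
  exact: opp1_eq1.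
(* A minimal F cannot exceed the monochromatic edges that it contains. *)
by apply/eqP; rewrite eqn_leq le_mono subset_leq_card.
Qed.
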